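(* Let $(\mathfrak{g},\eta)$ be a DS-contact Lie algebra with Reeb vector $\xi$, and put $\mathfrak{t}:=\ker\operatorname{ad}_\xi$, $\mathfrak{q}:=\operatorname{im}\operatorname{ad}_\xi$, $\mathfrak{t}_0:=\mathfrak{t}\cap\ker\eta$. Assume $\mathfrak{q}\neq0$ and $\dim\mathfrak{t}\geq3$. Then $(\mathfrak{t}_0,\omega_{\mathfrak{t}})$ is a Frobenius Lie algebra. In fact, $\omega_{\mathfrak{t}}=d_{\mathfrak{t}_0}\ell$, where $\ell\in\mathfrak{t}_0^*$ is given by $\ell(x)=\frac{1}{\dim\mathfrak{q}}\operatorname{tr}(A^{-1}\rho(x))$ for $x\in\mathfrak{t}_0$.
   Context: All Lie algebras are real and finite-dimensional. A contact Lie algebra is a pair $(\mathfrak{g},\eta)$ with $\dim\mathfrak{g}=2n+1$ and $\eta\in\mathfrak{g}^*$ such that $\eta\wedge(d\eta)^n\neq 0$, where $d\eta(x,y)=-\eta([x,y])$. Its Reeb vector is the unique $\xi\in\mathfrak{g}$ with $\eta(\xi)=1$ and $d\eta(\xi,\cdot)=0$. It is DS-contact if $\mathfrak{g}=\ker\operatorname{ad}_\xi\oplus\operatorname{im}\operatorname{ad}_\xi$ as vector spaces. In this case $[\mathfrak{t},\mathfrak{t}]\subseteq\mathfrak{t}$, $[\mathfrak{t},\mathfrak{q}]\subseteq\mathfrak{q}$, $\mathfrak{t}=\mathbb{R}\xi\oplus\mathfrak{t}_0$, and $\mathfrak{t}_0$ is a Lie algebra with bracket $\alpha(x,y):=$ the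 $\mathfrak{t}_0$-component of $[x,y]$. $\omega_{\mathfrak{t}}:=-(d\eta)|_{\mathfrak{t}_0}$, i.e. $\omega_{\mathfrak{t}}(x,y)=\eta([x,y])$. $A:=\operatorname{ad}_\xi|_{\mathfrak{q}}\in\operatorname{End}(\mathfrak{q})$ (invertible) and $\rho(x):=\operatorname{ad}_x|_{\mathfrak{q}}\in\operatorname{End}(\mathfrak{q})$ for $x\in\mathfrak{t}_0$. The differential is $d_{\mathfrak{t}_0}\ell(x,y)=-\ell(\alpha(x,y))$. A Frobenius Lie algebra is a Lie algebra equipped with an exact symplectic form (a nondegenerate $2$-form which is the differential of a $1$-form). *)

(* Defs.v *)
From mathcomp Require Import all_boot all_order all_fingroup all_algebra.
From mathcomp Require Import reals.

Set Implicit Arguments.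
Unset Strict Implicit.
Unset Printing Implicit Defensive.

Import GRing.Theory.
Local Open Scope ring_scope.

Section MultilinearForms.
Variables (R : realType) (V : vectType R).

Definition form (k : nat) : Type := ('I_k -> V) -> R.

(* With the factor 1/(p! q!) the product is associative on alternating forms
   and (a /\ b)(x, y) = a x * b y - a y * b x on 1-forms. *)
Definition wedge (p q : nat) (a : form p) (b : form q) : form (p + q) :=
  fun v => (p`! * q`!)%:R^-1 *
    \sum_(s : 'S_(p + q)) (-1) ^+ s *
       (a (fun i => v (s (lshift q i))) * b (fun j => v (s (rshift p j)))).

(* (k.+1 * p)%N is convertible to (p + k * p)%N. *)
Fixpoint wedge_exp (p : nat) (a : form p) (k : nat) : form (k * p) :=
  if k is k'.+1 then @wedge p (k' * p) a (@wedge_exp p a k') else fun _ => 1.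

Definition form1 (l : 'Hom(V, R^o)) : form 1 := fun v => l (v ord0).

Definition form2 (w : V -> V -> R) : form 2 := fun v => w (v ord0) (v ord_max).

End MultilinearForms.

Arguments wedge {R V p q} a b _.
Arguments wedge_exp {R V p} a k _.

Section LieAlgebras.
Variables (R : realType) (V : vectType R).

Record lie_bracket (br : V -> V -> V) : Prop := LieBracket {
  lie_linear_l : forall y, linear (fun x => br x y);
  lie_linear_r : forall x, linear (br x);
  lie_alt : forall x, br x x = 0;
  lie_jacobi : forall x y z,
    br x (br y z) + br y (br z x) + br z (br x y) = 0
}.

Definition ad (br : V -> V -> V) (x : V) : 'End(V) := linfun (br x).

Definition lie_d (br : V -> V -> V) (l : 'Hom(V, R^o)) (x y : V) : R :=
  - l (br x y).

Definition nondegenerate_form (w : V -> V -> R) : Prop :=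
  forall x, (forall y, w x y = 0) -> x = 0.

Definition frobenius (br : V -> V -> V) (w : V -> V -> R) : Prop :=
  [/\ lie_bracket br,
      exists l : 'Hom(V, R^o), forall x y, w x y = lie_d br l x y
    & nondegenerate_form w].

(* Trace of an endomorphism, computed in a basis of V. *)
Definition lfun_trace (f : 'End(V)) : R :=
  \tr (passmx.mxof (vbasis {:V}) (vbasis {:V}) f).

End LieAlgebras.

Section ContactLieAlgebras.
Variables (R : realType) (g : vectType R).
Variables (br : g -> g -> g) (eta : 'Hom(g, R^o)).

Definition contact : Prop :=
  lie_bracket br /\
  exists n : nat, \dim {:g} = (1 + n * 2)%N /\
    exists v : 'I_(1 + n * 2) -> g,
      wedge (form1 eta) (wedge_exp (form2 (lie_d br eta)) n) v != 0.

Definition reeb (xi : g) : Prop :=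
  eta xi = 1 /\ forall y, lie_d br eta xi y = 0.

Variable xi : g.

Definition tspace : {vspace g} := lker (ad br xi).
Definition qspace : {vspace g} := limg (ad br xi).
Definition t0space : {vspace g} := (tspace :&: lker eta)%VS.

Definition ds_contact : Prop :=
  [/\ contact, reeb xi, (tspace + qspace)%VS = fullv
    & directv (tspace + qspace)].

(* daddv_pi U W is the projection onto U along W; here t = t0 (+) R xi. *)
Definition t0_bracket (x y : subvs_of t0space) : subvs_of t0space :=
  vsproj t0space (daddv_pi t0space <[xi]>%VS (br (vsval x) (vsval y))).

Definition omega_t (x y : subvs_of t0space) : R :=
  - lie_d br eta (vsval x) (vsval y).

(* The restriction of ad x to q; vsproj only performs the change of type when
   ad x maps q to q, which is the case for x = xi and for x in t. *)
Definition ad_q (x : g) : 'End(subvs_of qspace) :=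
  linfun (fun u : subvs_of qspace => vsproj qspace (ad br x (vsval u))).

Definition A_q : 'End(subvs_of qspace) := ad_q xi.

Definition rho (x : subvs_of t0space) : 'End(subvs_of qspace) := ad_q (vsval x).

End ContactLieAlgebras.

(* Main.v *)
From HB Require Import structures.
Require Import Defs.
From mathcomp Require Import all_boot all_order all_fingroup all_algebra.
From mathcomp Require Import boolp reals.

Set Implicit Arguments.
Unset Strict Implicit.
Unset Printing Implicit Defensive.

Import GRing.Theory Num.Theory.
Local Open Scope ring_scope.

(** Let x, y be in t0. As x and y commute with xi, the bracket [x, y] lies in
    t = t0 (+) R xi, and its components are alpha(x, y) and
    omega_t(x, y) xi, because eta xi = 1. Both rho x and rho y act on q, so
    Leibniz' rule gives the identity of endomorphisms of q
      [rho x, rho y] = rho (alpha(x, y)) + omega_t(x, y) A   ([rho_bracket]).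
    The map A is injective since t and q meet trivially, and it commutes with
    rho x and rho y ([rho_A_q]). Hence A^-1 rho x rho y and A^-1 rho y rho x
    have equal traces, and composing the identity with A^-1 and taking the
    trace yields
      0 = tr (A^-1 rho (alpha(x, y))) + omega_t(x, y) dim q,
    which is omega_t = d l after division by dim q.

    The Jacobi identity of alpha is the t0-component of that of g: the part of
    [y, z] along xi is invisible to a further bracket with an element of t.

    For nondegeneracy, x in t0 with omega_t(x, .) = 0 also satisfies
    eta [x, xi] = 0 and eta [x, q] = 0, the latter because [t, q] is contained
    in q and eta vanishes on q. So x lies in ker eta and in the kernel of
    d eta; were it nonzero, every factor of eta /\ (d eta)^n would vanish when
    one argument is x, and an alternating form of top degree with this
    property is zero ([top_form_eq0]), contrary to the contact condition. *)

(** * Alternating multilinear forms *)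

Section TopForms.
Variables (R : realType) (V : vectType R).

Definition upd k (v : 'I_k -> V) (i : 'I_k) (u : V) : 'I_k -> V :=
  fun j => if j == i then u else v j.

Definition multilinear k (F : Defs.form V k) : Prop :=
  forall v i a u w,
    F (upd v i (a *: u + w)) = a * F (upd v i u) + F (upd v i w).

Definition alternating k (F : Defs.form V k) : Prop :=
  forall v i j, i != j -> v i = v j -> F v = 0.

(** For an alternating form this says that its interior product with x is
    zero. Unlike the interior product it keeps the number of arguments, and so
    it passes to wedge products without reindexing. *)
Definition killed_by (x : V) k (F : Defs.form V k) : Prop :=
  forall v i, v i = x -> F v = 0.

Lemma multilinear_sum k (F : Defs.form V k) v i n
    (c : 'I_n -> R) (w : 'I_n -> V) :
  multilinear F ->
  F (upd v i (\sum_j c j *: w j)) = \sum_j c j * F (upd v i (w j)).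
Proof.
move=> linF; elim/big_rec2: _ => [|j y1 y2 _ <-]; last exact: linF.
by rewrite -[0 in LHS](addNr 0) -scaleN1r linF mulN1r addNr.
Qed.

Lemma upd_injective k n (f : 'I_n -> 'I_k) (v : 'I_k -> V) i u :
  injective f -> (fun j => upd v (f i) u (f j)) = upd (v \o f) i u.
Proof. by move=> injf; apply/funext => j; rewrite /upd (inj_eq injf). Qed.

Lemma upd_notin k n (f : 'I_n -> 'I_k) (v : 'I_k -> V) i u :
  (forall j, f j != i) -> (fun j => upd v i u (f j)) = v \o f.
Proof. by move=> fNi; apply/funext => j; rewrite /upd (negPf (fNi j)). Qed.

(** In each term of the antisymmetrization, the slot i of v is read by exactly
    one argument of exactly one of the two factors, namely at s^-1 i; the other
    factor does not see a change in that slot. *)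
Lemma wedge_multilinear p q (a : Defs.form V p) (b : Defs.form V q) :
  multilinear a -> multilinear b -> multilinear (wedge a b).
Proof.
move=> lin_a lin_b v i c u w; rewrite /wedge (mulrCA c) -mulrDr; congr (_ * _).
rewrite mulr_sumr -big_split /=; apply: eq_bigr => s _.
rewrite (mulrCA c) -mulrDr; congr (_ * _).
have lsN j k : s (lshift q j) != s (rshift p k).
  by rewrite (inj_eq perm_inj) eq_lrshift.
have injl : injective (s \o lshift q).
  by apply: inj_comp perm_inj (@lshift_inj _ _).
have injr : injective (s \o @rshift p q).
  by apply: inj_comp perm_inj (@rshift_inj _ _).
have := permKV s i; case: (split_ordP ((s^-1)%g i)) => j -> <-.
  rewrite !(upd_injective (f := s \o lshift q)) //.
  have rN k : s (rshift p k) != s (lshift q j) by rewrite eq_sym.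
  rewrite !(upd_notin (f := s \o @rshift p q) _ _ rN).
  by rewrite lin_a mulrDl mulrA.
rewrite !(upd_injective (f := s \o @rshift p q)) //.
rewrite !(upd_notin (f := s \o lshift q) _ _ (lsN^~ j)).
by rewrite lin_b mulrDr mulrCA.
Qed.

Lemma wedge_killed_by x p q (a : Defs.form V p) (b : Defs.form V q) :
  killed_by x a -> killed_by x b -> killed_by x (wedge a b).
Proof.
move=> ka kb v i vi; rewrite /wedge big1 ?mulr0 // => s _.
have := permKV s i; case: (split_ordP ((s^-1)%g i)) => j -> sj.
  by rewrite (ka _ j) ?mul0r ?mulr0 //= sj.
by rewrite (kb _ j) ?mulr0 //= sj.
Qed.

(** If v takes the same value at i and j, composing the permutation with the
    transposition of i and j leaves the product unchanged and flips the sign,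
    so the antisymmetrization equals its opposite. *)
Lemma wedge_alternating p q (a : Defs.form V p) (b : Defs.form V q) :
  alternating (wedge a b).
Proof.
move=> v i j ij vij; rewrite /wedge; set S := \sum_s _.
suff -> : S = 0 by rewrite mulr0.
have vt k : v (tperm i j k) = v k by case: tpermP => // ->.
suff /eqP : S = - S by rewrite -addr_eq0 -mulr2n mulrn_eq0 /= => /eqP.
rewrite /S [LHS](reindex_inj (mulIg (tperm i j))) /= -sumrN.
apply: eq_bigr => s _; rewrite odd_permM odd_tperm ij addbT signrN mulNr.
by congr (- (_ * (a _ * b _))); apply/funext => k; rewrite permM vt.
Qed.

Lemma wedge_exp_multilinear p (a : Defs.form V p) k :
  multilinear a -> multilinear (wedge_exp a k).
Proof.
move=> lin_a; elim: k => [v [] //|k IHk].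
exact: (wedge_multilinear lin_a IHk).
Qed.

Lemma wedge_exp_killed_by x p (a : Defs.form V p) k :
  killed_by x a -> killed_by x (wedge_exp a k).
Proof.
move=> ka; elim: k => [v [] //|k IHk].
exact: (wedge_killed_by ka IHk).
Qed.

(** The k vectors v i together with x cannot be independent in dimension k.
    So some combination of the v i with a nonzero coefficient at an index i
    equals x or 0; putting it into slot i makes F vanish, while expanding it
    there leaves only that coefficient times F v. *)
Lemma top_form_eq0 k (F : Defs.form V k) x (v : 'I_k -> V) :
  multilinear F -> alternating F -> killed_by x F -> x != 0 ->
  \dim {:V} = k -> F v = 0.
Proof.
move=> linF altF kF x0 dimV.
suff [c [i [ci0 F0]]] : exists c : 'I_k -> R, exists i,
    c i != 0 /\ F (upd v i (\sum_j c j *: v j)) = 0.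
  move: F0; rewrite multilinear_sum // (bigD1 i) //= big1 => [|j ji].
    rewrite addr0 => /eqP; rewrite mulf_eq0 (negPf ci0) => /eqP <-.
    by congr F; apply/funext => l; rewrite /upd; case: eqP => // ->.
  by rewrite (altF _ j i) ?mulr0 // /upd eqxx (negPf ji).
pose X := [tuple v i | i < k].
have [fX|] := boolP (free X).
  have bX : basis_of {:V} X by rewrite basisEfree fX subvf size_tuple dimV /=.
  have xE := coord_basis bX (memvf x).
  have [i ci|c0] := pickP (fun i => coord X i x != 0).
    exists (fun i => coord X i x), i; split=> //; apply: (kF _ i).
    rewrite /upd eqxx [RHS]xE; apply: eq_bigr => j _.
    by rewrite (nth_mktuple v).
  case/eqP: x0; rewrite xE big1 // => i _.
  by move/negbFE/eqP: (c0 i) => ->; rewrite scale0r.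
move=> nfX; have /existsNP[c /not_implyP[c0 /existsNP[i /eqP ci]]] :
  ~ forall c, \sum_(i < k) c i *: X`_i = 0 -> forall i, c i = 0.
  by move/(freeP (X := X)); apply/negP.
exists c, i; split=> //.
have -> : \sum_j c j *: v j = 0.
  by rewrite -[RHS]c0; apply: eq_bigr => j _; rewrite (nth_mktuple v).
(* The empty sum shows that F vanishes when one of its arguments is 0. *)
have := @multilinear_sum _ F v i 0 (fun=> 0) (fun=> 0) linF.
by rewrite !big_ord0.
Qed.

End TopForms.

(** * Bracket identities and the kernel of a contact form *)

(** For functions that come with a proof of linearity instead of a canonical
    structure, such as [br x]. *)
Lemma linfunE (K : fieldType) (aT rT : vectType K) (f : aT -> rT) :
  linear f -> linfun f =1 f.
Proof.
move=> lin_f.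
pose F : {linear aT -> rT} := HB.pack f (GRing.isLinear.Build _ _ _ _ f lin_f).
exact: (lfunE F).
Qed.

Section ContactKernel.
Variables (R : realType) (g : vectType R) (br : g -> g -> g).
Variable eta : 'Hom(g, R^o).

Hypothesis Lg : lie_bracket br.

Lemma adE x y : ad br x y = br x y.
Proof. exact/linfunE/(lie_linear_r Lg). Qed.

Lemma bracketDl x y z : br (x + y) z = br x z + br y z.
Proof. by have := lie_linear_l Lg z 1 x y; rewrite !scale1r. Qed.

Lemma bracketC x y : br x y = - br y x.
Proof.
apply/eqP; rewrite -addr_eq0; apply/eqP.
have := lie_alt Lg (x + y).
by rewrite bracketDl -!adE !linearD /= !adE !(lie_alt Lg) add0r addr0.
Qed.

Lemma bracket0r x : br x 0 = 0.
Proof. by rewrite -adE linear0. Qed.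

Lemma bracket0l x : br 0 x = 0.
Proof. by rewrite bracketC bracket0r oppr0. Qed.

Lemma bracket_leibniz x y z : br x (br y z) = br (br x y) z + br y (br x z).
Proof.
have := lie_jacobi Lg x y z.
rewrite (bracketC z (br x y)) (bracketC z x) -(adE y (- _)) linearN /= adE.
by move/eqP; rewrite -addrA -opprD subr_eq0 addrC => /eqP.
Qed.

(** Such an x kills eta and d eta as forms, hence also eta /\ (d eta)^n, which
    has top degree and is nonzero. *)
Lemma contact_kernel_eq0 x :
  contact br eta -> eta x = 0 -> (forall y, eta (br x y) = 0) -> x = 0.
Proof.
move=> [_ [n [dim_g [v F_v]]]] eta_x eta_brx; apply: contraNeq F_v => x_neq0.
apply/eqP; apply: (top_form_eq0 _ _ _ _ x_neq0) => //.
- apply: wedge_multilinear.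
    by move=> w i a u z; rewrite /form1 (ord1 i) /upd eqxx linearP.
  apply: wedge_exp_multilinear => w i a u z; rewrite /form2 /lie_d /upd.
  have [->|i1] := eqVneq i ord0.
    by rewrite /= (lie_linear_l Lg) linearP /= opprD mulrN.
  have -> : i = ord_max by apply: val_inj; case: i i1 => [[|[|?]]].
  by rewrite eqxx /= (lie_linear_r Lg) linearP /= opprD mulrN.
- exact: wedge_alternating.
- apply: wedge_killed_by => [w i|]; first by rewrite /form1 (ord1 i) => ->.
  apply: wedge_exp_killed_by => w i; rewrite /form2 /lie_d.
  have [-> ->|i1] := eqVneq i ord0; first by rewrite eta_brx oppr0.
  have -> : i = ord_max by apply: val_inj; case: i i1 => [[|[|?]]].
  by move=> ->; rewrite bracketC linearN /= eta_brx !oppr0.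
Qed.

End ContactKernel.

(** * The trace of an endomorphism *)

Section Trace.
Variables (R : realType) (V : vectType R).

Lemma lfun_trace_is_linear : linear (@lfun_trace R V : 'End(V) -> R^o).
Proof.
by move=> a f h; rewrite /lfun_trace passmx.mxof_linear mxtraceD mxtraceZ.
Qed.

Lemma lfun_traceC (f h : 'End(V)) :
  lfun_trace (f \o h)%VF = lfun_trace (h \o f)%VF.
Proof.
have bV := vbasisP {:V}.
by rewrite /lfun_trace !(passmx.mxof_comp _ _ bV) mxtrace_mulC.
Qed.

Lemma lfun_trace1 : lfun_trace (\1%VF : 'End(V)) = (\dim {:V})%:R.
Proof.
by rewrite /lfun_trace passmx.mxof1 ?mxtrace1 // (basis_free (vbasisP _)).
Qed.

End Trace.

(** * DS-contact Lie algebras *)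

Section DSContact.
Variables (R : realType) (g : vectType R) (br : g -> g -> g).
Variables (eta : 'Hom(g, R^o)) (xi : g).
Hypothesis ds : ds_contact br eta xi.

Local Notation t := (tspace br xi).
Local Notation q := (qspace br xi).
Local Notation t0 := (t0space br eta xi).

Let Lg : lie_bracket br. Proof. by case: ds => [[]]. Qed.

Lemma mem_tspace x : (x \in t) = (br xi x == 0).
Proof. by rewrite memv_ker adE. Qed.

Lemma bracket_xi x : x \in t -> br x xi = 0.
Proof. by rewrite mem_tspace (bracketC Lg x) => /eqP ->; rewrite oppr0. Qed.

Lemma mem_qspace x : br xi x \in q.
Proof. by rewrite -(adE Lg) memv_img ?memvf. Qed.

Lemma bracket_tspace x y : x \in t -> y \in t -> br x y \in t.
Proof.
move=> tx; rewrite !mem_tspace (bracket_leibniz Lg) => /eqP ty.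
move: tx; rewrite mem_tspace => /eqP ->.
by rewrite ty bracket0l // bracket0r // addr0.
Qed.

(** An element of t commutes with xi, hence ad x commutes with ad xi and
    preserves its image. *)
Lemma bracket_qspace x u : x \in t -> u \in q -> br x u \in q.
Proof.
move=> tx /memv_imgP[w _ ->]; rewrite adE // (bracket_leibniz Lg).
rewrite bracket_xi // bracket0l // add0r.
exact: mem_qspace.
Qed.

Lemma tspace_capq : (t :&: q = 0)%VS.
Proof. by apply/directv_addP; case: ds. Qed.

Lemma eta_xi : eta xi = 1. Proof. by case: ds => _ []. Qed.

Lemma eta_scale_xi c : eta (c *: xi) = c.
Proof. by rewrite linearZ /= eta_xi; exact: mulr1. Qed.

Lemma eta_bracket_xi y : eta (br xi y) = 0.
Proof. by case: ds => _ [_ /(_ y)/eqP]; rewrite oppr_eq0 => /eqP. Qed.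

(** The image of ad xi is killed by eta because d eta (xi, .) = 0. *)
Lemma eta_qspace u : u \in q -> eta u = 0.
Proof. by case/memv_imgP=> w _ ->; rewrite adE // eta_bracket_xi. Qed.

Lemma xi_tspace : xi \in t.
Proof. by rewrite mem_tspace (lie_alt Lg). Qed.

Lemma mem_t0space x : (x \in t0) = (x \in t) && (eta x == 0).
Proof. by rewrite memv_cap memv_ker. Qed.

Lemma t0space_t (x : subvs_of t0) : vsval x \in t.
Proof. by have := subvsP x; rewrite mem_t0space => /andP[]. Qed.

Lemma t0space_eta (x : subvs_of t0) : eta (vsval x) = 0.
Proof. by have := subvsP x; rewrite mem_t0space => /andP[_ /eqP]. Qed.

Lemma t0space_component x : x \in t -> x - eta x *: xi \in t0.
Proof.
move=> tx; rewrite mem_t0space rpredB ?rpredZ ?xi_tspace //=.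
by rewrite linearB /= eta_scale_xi subrr.
Qed.

(** Since eta xi = 1 and t0 = t :&: ker eta, the component along xi of an
    element of t is read off by eta. *)
Lemma daddv_pi_t0 x : x \in t -> daddv_pi t0 <[xi]>%VS x = x - eta x *: xi.
Proof.
move=> tx.
have cap0 : (t0 :&: <[xi]> = 0)%VS.
  apply/eqP; rewrite -subv0; apply/subvP => y; rewrite memv_cap mem_t0space.
  case/andP=> /andP[_ eta_y] /vlineP[c yE]; move: eta_y.
  by rewrite yE eta_scale_xi => /eqP ->; rewrite scale0r mem0v.
have t0x := t0space_component tx.
have xix : eta x *: xi \in <[xi]>%VS by rewrite rpredZ ?memv_line.
rewrite -{1}(subrK (eta x *: xi) x) linearD /= daddv_pi_id //.
have := daddv_pi_add cap0 (subvP (addvSr _ _) _ xix).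
rewrite [X in _ + X]daddv_pi_id ?xix //; last by rewrite capvC.
by move/(canRL (addrK _)) => ->; rewrite subrr addr0.
Qed.

Lemma t0_bracketE x y :
  vsval (t0_bracket x y) =
  br (vsval x) (vsval y) - @omega_t R g br eta xi x y *: xi.
Proof.
have t_xy := bracket_tspace (t0space_t x) (t0space_t y).
rewrite /t0_bracket daddv_pi_t0 // vsprojK ?t0space_component //.
by rewrite /omega_t /lie_d opprK.
Qed.

Lemma omega_tE x y : @omega_t R g br eta xi x y = eta (br (vsval x) (vsval y)).
Proof. exact: opprK. Qed.

Lemma t0_lie_bracket : lie_bracket (@t0_bracket R g br eta xi).
Proof.
have brl z a x y : br (a *: x + y) z = a *: br x z + br y z.
  exact: lie_linear_l.
have brr z a x y : br z (a *: x + y) = a *: br z x + br z y.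
  exact: lie_linear_r.
split.
- move=> z a x y; apply: val_inj.
  rewrite /= !t0_bracketE !omega_tE /= brl linearP /=.
  by rewrite scalerDl -scalerA scalerBr opprD addrACA.
- move=> z a x y; apply: val_inj.
  rewrite /= !t0_bracketE !omega_tE /= brr linearP /=.
  by rewrite scalerDl -scalerA scalerBr opprD addrACA.
- move=> x; apply: val_inj; rewrite /= t0_bracketE omega_tE (lie_alt Lg).
  by rewrite !linear0 scale0r subr0.
(* The term of [y, z] along xi disappears here, since x commutes with xi. *)
have nested (x y z : subvs_of t0) : vsval (t0_bracket x (t0_bracket y z)) =
    br (vsval x) (br (vsval y) (vsval z))
    - eta (br (vsval x) (br (vsval y) (vsval z))) *: xi.
  rewrite t0_bracketE omega_tE t0_bracketE -!(adE Lg (vsval x)).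
  rewrite linearB linearZ /=.
  by rewrite (adE Lg _ xi) bracket_xi ?t0space_t // scaler0 subr0.
move=> x y z; apply: val_inj; rewrite /= !nested.
rewrite [X in X + _]addrACA -opprD -scalerDl addrACA -opprD -scalerDl.
rewrite -!(linearD eta) /=.
by rewrite (lie_jacobi Lg) !linear0 scale0r subr0.
Qed.

(** Decomposing g as R xi (+) t0 (+) q, only the part in t0 contributes to
    eta [x, .] for x in t0, so the kernel of omega_t lies in that of d eta. *)
Lemma omega_t_nondegenerate : nondegenerate_form (@omega_t R g br eta xi).
Proof.
move=> x omega_x; apply: val_inj => /=.
apply: (contact_kernel_eq0 Lg (eta := eta)).
- by case: ds.
- exact: t0space_eta.
move=> y; have : y \in (t + q)%VS by have [_ _ tq _] := ds; rewrite tq memvf.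
case/memv_addP=> a ta [b qb ->].
rewrite -(adE Lg) linearD /= !adE // linearD /=.
rewrite (eta_qspace (bracket_qspace (t0space_t x) qb)) addr0.
rewrite -(subrK (eta a *: xi) a) addrC (lie_linear_r Lg).
rewrite bracket_xi ?t0space_t // scaler0 add0r.
have := omega_x (vsproj t0 (a - eta a *: xi)).
by rewrite omega_tE vsprojK // t0space_component.
Qed.

Lemma ad_qE x u : x \in t -> vsval (ad_q br xi x u) = br x (vsval u).
Proof.
move=> tx; rewrite /ad_q linfunE; last by move=> a v w; rewrite !linearP.
by rewrite vsprojK adE // bracket_qspace // subvsP.
Qed.

Lemma A_q_inj : lker (A_q br xi) == 0%VS.
Proof.
rewrite -subv0; apply/subvP => u; rewrite memv_ker memv0 => /eqP/(congr1 vsval).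
rewrite ad_qE ?xi_tspace // linear0 => Au; apply/eqP/val_inj => /=; apply/eqP.
by rewrite -memv0 -tspace_capq memv_cap mem_tspace Au eqxx subvsP.
Qed.

(** The component of [x, y] along xi turns into a multiple of A: this is how
    omega_t enters the representation on q. *)
Lemma rho_bracket (x y : subvs_of t0) :
  ((rho x \o rho y) - (rho y \o rho x) =
   rho (t0_bracket x y) + @omega_t R g br eta xi x y *: A_q br xi)%VF.
Proof.
have tx := t0space_t x; have ty := t0space_t y.
apply/lfunP => u; apply: val_inj; rewrite !lfun_simp /=.
rewrite !ad_qE ?xi_tspace ?t0space_t // t0_bracketE.
rewrite (bracket_leibniz Lg) addrK [RHS]addrC.
rewrite -[X in _ = _ + br X _]addrC -scaleNr (lie_linear_l Lg) addrA -scalerDl.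
by rewrite subrr scale0r add0r.
Qed.

Lemma rho_A_q (x : subvs_of t0) : (A_q br xi \o rho x = rho x \o A_q br xi)%VF.
Proof.
have tx := t0space_t x.
apply/lfunP => u; apply: val_inj; rewrite !lfun_simp /=.
rewrite !ad_qE ?xi_tspace // (bracket_leibniz Lg).
move: tx; rewrite mem_tspace => /eqP ->.
by rewrite bracket0l // add0r.
Qed.

Lemma rho_linear : linear (@rho R g br eta xi).
Proof.
move=> a x y; apply/lfunP => u; apply: val_inj.
by rewrite !lfun_simp /= !ad_qE ?t0space_t // linearP (lie_linear_l Lg).
Qed.

End DSContact.

Theorem theorem5p4 (R : realType) (g : vectType R) (br : g -> g -> g)
    (eta : 'Hom(g, R^o)) (xi : g)
    (ds : ds_contact br eta xi)
    (q_neq0 : qspace br xi <> 0%VS)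
    (dim_t : (3 <= \dim (tspace br xi))%N) :
  frobenius (@t0_bracket R g br eta xi) (@omega_t R g br eta xi) /\
  exists l : 'Hom(subvs_of (t0space br eta xi), R^o),
    (forall x, l x = (\dim (qspace br xi))%:R^-1 *
                     lfun_trace ((A_q br xi)^-1 \o rho x)%VF) /\
    (forall x y, omega_t x y = lie_d (@t0_bracket R g br eta xi) l x y).
Proof.
set A := A_q br xi; set N := (\dim (qspace br xi))%:R.
have N0 : N != 0 by rewrite pnatr_eq0 dimv_eq0; apply/eqP.
pose tau (x : subvs_of (t0space br eta xi)) : R^o :=
  N^-1 * lfun_trace (A^-1 \o rho x)%VF.
have tau_lin : linear tau.
  move=> a x y; rewrite /tau (rho_linear ds) comp_lfunDr -comp_lfunZr.
  by rewrite lfun_trace_is_linear mulrDr mulrCA.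
have trace_bracket (x y : subvs_of (t0space br eta xi)) :
    lfun_trace (A^-1 \o rho (t0_bracket x y))%VF + omega_t x y * N = 0.
  have A0 : lker A == 0%VS by exact: A_q_inj ds.
  have AV (z : subvs_of (t0space br eta xi)) :
      (A^-1 \o rho z = rho z \o A^-1)%VF.
    have /(congr1 (fun f => A^-1 \o (f \o A^-1))%VF) := rho_A_q ds z.
    rewrite -comp_lfunA lker0_compKf // => ->.
    by rewrite lker0_compfK.
  (* Cyclicity of the trace, combined with A^-1 commuting with rho y. *)
  have tr_sym : lfun_trace (A^-1 \o (rho x \o rho y))%VF =
                lfun_trace (A^-1 \o (rho y \o rho x))%VF.
    by rewrite [in LHS]comp_lfunA [LHS]lfun_traceC comp_lfunA -AV comp_lfunA.
  have : lfun_trace (A^-1 \o ((rho x \o rho y) - (rho y \o rho x)))%VF = 0.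
    rewrite comp_lfunDr comp_lfunNr -scaleN1r addrC lfun_trace_is_linear.
    by rewrite tr_sym scaleN1r addNr.
  rewrite rho_bracket // comp_lfunDr -comp_lfunZr addrC lfun_trace_is_linear.
  by rewrite lker0_compVf // lfun_trace1 dimvf addrC.
have omegaE (x y : subvs_of (t0space br eta xi)) :
    omega_t x y = lie_d (@t0_bracket R g br eta xi) (linfun tau) x y.
  rewrite /lie_d linfunE // /tau; move/eqP: (trace_bracket x y).
  by rewrite addr_eq0 => /eqP ->; rewrite mulrN opprK mulrC mulfK.
split; last by exists (linfun tau); split=> // x; rewrite linfunE.
split; [exact: t0_lie_bracket | by exists (linfun tau) |].
exact: omega_t_nondegenerate.
Qed.
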